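(* Suppose online decision-making is carried out with the FRONT algorithm and that the following two assumptions hold. (Boundedness) There exist positive constants $L_x,\lambda$ such that $\|\phi(\bm{x})\|_\infty\le L_x$ for all $\bm{x}\sim\mathcal{P}_X$ and $\lambda_{\min}(\mathbb{E}[\phi(\bm{x})\phi(\bm{x})^{\top}])>\lambda$. Moreover there is a positive constant $L_z\ge L_x$ such that $\sum_{s=1}^{t-1}|w_{ts}|\le L_z$ for all $t$; then $\|\bm{z}_t\|_\infty\le L_z$ for any $t$. (Clipping) There is a constant $C$ such that, for any time step $t\ge1$, $\lambda_{\min}\left\{\frac1t\sum_{s=1}^{t}\bm{z}_s\bm{z}_s^{\top}\right\}>C\epsilon_t$. Then for every $h>0$, the online estimator $\widehat{\bm{\theta}}_t$ at time step $t$ satisfies $$\Pr\left\{\left\|\widehat{\bm{\theta}}_t-\bm{\theta}\right\|_1\le h\right\}\ \ge\ 1-4d_1\exp\left\{-\frac{t\epsilon_t^2C^2h^2}{2d^2\sigma^2L_z^2}\right\}-4\exp\left\{-\frac{t\epsilon_t^2C^2h^2}{8d^2\sigma^2L_z^2}\right\}.$$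
   Context: Model. Individuals $t=1,2,\dots$ arrive sequentially with i.i.d. contexts $\bm{x}_t\sim\mathcal{P}_X$ on $\mathbb{R}^{d_0}$ (one coordinate is the constant $1$); an action $a_t\in\{0,1\}$ is chosen and a reward $y_t$ observed; $\mathcal{H}_t=\{\bm{x}_s,a_s,y_s\}_{s\le t}$. With a known real weight array $\{w_{ts}\}_{t\ge1,s<t}$ put $\kappa_t=\sum_{s=1}^{t-1}w_{ts}a_s$ and $\zeta_t=\sum_{s=t+1}^{\infty}w_{st}$. With a feature map $\phi:\mathbb{R}^{d_0}\to\mathbb{R}^{d_1}$ and true parameters $\bm{\beta}_0,\bm{\beta}_1\in\mathbb{R}^{d_1}$, $\gamma\in\mathbb{R}$, $$y_t=(1-a_t)\phi(\bm{x}_t)^{\top}\bm{\beta}_0+a_t\phi(\bm{x}_t)^{\top}\bm{\beta}_1+\kappa_t\gamma+e_t ,$$ the part without $e_t$ being the conditional mean of $y_t$ given $\bm{x}_t,\kappa_t,a_t$. The noise $e_t$ is $\sigma$-subgaussian and, conditionally on $a_t$, independent of $\bm{x}_t$ and $\mathcal{H}_{t-1}$; given $a_t=i$ it has distribution $\mathcal{P}_{e_i}$ with $\mathbb{E}(e_t^2\mid a_t=i)=\sigma_i^2<\sigma^2$. Put $d=2d_1+1$, $\bm{z}_t=((1-a_t)\phi(\bm{x}_t)^{\top},a_t\phi(\bm{x}_t)^{\top},\kappa_t)^{\top}\in\mathbb{R}^d$, $\bm{\theta}=(\bm{\beta}_0^{\top},\bm{\beta}_1^{\top},\gamma)^{\top}$.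 The online estimator (defined when the matrix is invertible) is $$\widehat{\bm{\theta}}_t=(\widehat{\bm{\beta}}_{0,t}^{\top},\widehat{\bm{\beta}}_{1,t}^{\top},\widehat{\gamma}_t)^{\top}=\left(\tfrac1t\sum_{s=1}^t\bm{z}_s\bm{z}_s^{\top}\right)^{-1}\left(\tfrac1t\sum_{s=1}^t\bm{z}_sy_s\right).$$ FRONT algorithm. Inputs: clipping parameter $C$ (the constant of the clipping assumption), threshold $\kappa_0$, number of force pulls $K$, warm-up length $T_0$, warm-up parameter $L$, exploration probabilities $\epsilon_t$. For $t\le T_0$ (warm-up): $a_t=1$ if $t\in\bigcup_{i=1}^{L}((i-1)T_0/L,(2i-1)T_0/(2L)]$ and $a_t=0$ if $t\in\bigcup_{i=1}^{L}((2i-1)T_0/(2L),iT_0/L]$. For $t>T_0$, unless $a_t$ has been fixed by an earlier force pull: draw $a_t\sim\mathrm{Bernoulli}(\widehat{\pi}_t(\bm{x}_t))$ with $$\widehat{\pi}_t(\bm{x}_t)=(1-\epsilon_t)\,\mathbb{I}\{\phi(\bm{x}_t)^{\top}(\widehat{\bm{\beta}}_{1,t-1}-\widehat{\bm{\beta}}_{0,t-1})+\zeta_t\widehat{\gamma}_{t-1}\ge0\}+\epsilon_t/2;$$ if then $\lambda_{\min}\{\frac1t\sum_{s=1}^t\bm{z}_s\bm{z}_s^{\top}\}\le C\epsilon_t$, perform force pulls: set $a_t=a_{t+1}=\dots=a_{t+K}$ equal to $1$ if $\kappa_t\le\kappa_0$ and to $0$ otherwise. $\lambda_{\min}$ denotes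 the smallest eigenvalue.
   Formalization: C is assumed positive (for C<0 clipping can hold trivially while the bound, which involves C^2, fails); clipping is required only at the step t of the conclusion (at t=1 it cannot hold for C>0, the matrix having rank at most 1); the noise is taken σ-subgaussian given each action. *)

(* Defs.v *)
(* MathComp / MathComp-Analysis development. *)
From HB Require Import structures.
From mathcomp Require Import all_boot all_order all_algebra.
From mathcomp Require Import all_classical all_reals all_analysis.

Set Implicit Arguments.
Unset Strict Implicit.
Unset Printing Implicit Defensive.

Import Order.TTheory GRing.Theory Num.Theory.
Import numFieldNormedType.Exports.

Local Open Scope classical_set_scope.
Local Open Scope ring_scope.

(** ** Linear algebra *)

(* The set of real eigenvalues of a symmetric matrix of positive size is finite
   and nonempty, so this infimum is a minimum; the matrices below are symmetric. *)
Definition lambda_min (R : realType) (n : nat) (A : 'M[R]_n) : R :=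
  inf [set l : R | eigenvalue A l].

Definition l1norm (R : realType) (n : nat) (v : 'cV[R]_n) : R :=
  \sum_(i < n) `|v i 0|.

(** ** Trajectories

    Times are natural numbers t >= 1; the value at index 0 of a trajectory is
    never used.  Contexts are vectors of R^d0, encoded as [d0.-tuple R] to carry
    the product sigma-algebra; the action [true] is 1 and [false] is 0. *)

Definition kappa (R : realType) (w : nat -> nat -> R) (a : nat -> bool)
    (t : nat) : R :=
  \sum_(1 <= s < t) w t s * (a s)%:R.

(* Limit of the partial sums; a default value if they do not converge. *)
Definition zeta (R : realType) (w : nat -> nat -> R) (t : nat) : R :=
  limn (fun n => \sum_(t.+1 <= s < n) w s t).

Definition zvec (R : realType) (d0 d1 : nat) (phi : d0.-tuple R -> 'cV[R]_d1)
    (w : nat -> nat -> R) (x : nat -> d0.-tuple R) (a : nat -> bool)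
    (t : nat) : 'cV[R]_(d1 + d1 + 1) :=
  col_mx (col_mx ((1 - (a t)%:R) *: phi (x t)) ((a t)%:R *: phi (x t)))
         (kappa w a t)%:M.

Definition theta (R : realType) (d1 : nat) (beta0 beta1 : 'cV[R]_d1) (gamma : R)
    : 'cV[R]_(d1 + d1 + 1) :=
  col_mx (col_mx beta0 beta1) gamma%:M.

Definition gram (R : realType) (d : nat) (z : nat -> 'cV[R]_d) (t : nat)
    : 'M[R]_d :=
  t%:R^-1 *: \sum_(1 <= s < t.+1) z s *m (z s)^T.

(* Meaningful when [gram z t] is invertible. *)
Definition estimator (R : realType) (d : nat) (z : nat -> 'cV[R]_d)
    (y : nat -> R) (t : nat) : 'cV[R]_d :=
  invmx (gram z t) *m (t%:R^-1 *: \sum_(1 <= s < t.+1) y s *: z s).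

Definition est_beta0 (R : realType) (d1 : nat) (v : 'cV[R]_(d1 + d1 + 1))
  : 'cV[R]_d1 := usubmx (usubmx v).
Definition est_beta1 (R : realType) (d1 : nat) (v : 'cV[R]_(d1 + d1 + 1))
  : 'cV[R]_d1 := dsubmx (usubmx v).
Definition est_gamma (R : realType) (d1 : nat) (v : 'cV[R]_(d1 + d1 + 1))
  : R := dsubmx v 0 0.

Definition mean_reward (R : realType) (d0 d1 : nat)
    (phi : d0.-tuple R -> 'cV[R]_d1) (w : nat -> nat -> R)
    (beta0 beta1 : 'cV[R]_d1) (gamma : R)
    (x : nat -> d0.-tuple R) (a : nat -> bool) (t : nat) : R :=
  (1 - (a t)%:R) * ((phi (x t))^T *m beta0) 0 0
  + (a t)%:R * ((phi (x t))^T *m beta1) 0 0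
  + kappa w a t * gamma.

(** ** Probability *)

Definition path_of (T E : Type) (X : nat -> T -> E) (om : T) : nat -> E :=
  fun s => X s om.

(* Generators of sigma(X). *)
Definition events_of d d' (T : measurableType d) (E : measurableType d')
    (X : T -> E) : set (set T) :=
  preimage_set_system setT X measurable.

(* Generators of sigma(H_n), H_n = {x_s, a_s, y_s : 1 <= s <= n}. *)
Definition hist_events (R : realType) d (T : measurableType d) (d0 : nat)
    (x : nat -> T -> d0.-tuple R) (a : nat -> T -> bool) (y : nat -> T -> R)
    (n : nat) : set (set T) :=
  \bigcup_(s in [set s | (1 <= s <= n)%N])
    (events_of (x s) `|` events_of (a s) `|` events_of (y s)).

Definition iid d d' (T : measurableType d) (E : measurableType d')
    (R : realType) (P : probability T R) (Q : probability E R)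
    (X : nat -> T -> E) : Prop :=
  (forall (t : nat) (B : set E), (1 <= t)%N -> measurable B ->
     P (X t @^-1` B) = Q B) /\
  (forall (s : seq nat) (B : nat -> set E),
     uniq s -> all (leq 1) s -> (forall t, measurable (B t)) ->
     P [set om | forall t, t \in s -> B t (X t om)] =
     (\prod_(t <- s) P (X t @^-1` B t))%E).

(* M is the conditional mean of Y given the sigma-algebra generated by G. *)
Definition is_cond_mean d (T : measurableType d) (R : realType)
    (P : probability T R) (G : set (set T)) (Y M : T -> R) : Prop :=
  [/\ P.-integrable setT (EFin \o Y),
      P.-integrable setT (EFin \o M),
      (forall B : set R, measurable B -> <<s G >> (M @^-1` B)) &
      (forall D, <<s G >> D ->
         (\int[P]_(om in D) (Y om)%:E = \int[P]_(om in D) (M om)%:E)%E)].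

Definition subgaussian (R : realType) (sigma : R)
    (Q : probability (measurableTypeR R) R) : Prop :=
  forall u : R,
    ('M_Q (idfun : measurableTypeR R -> R) u <=
     (expR (u ^+ 2 * sigma ^+ 2 / 2))%:E)%E.

(** ** Reward model *)

Record reward_model (R : realType) (d0 d1 : nat)
    (phi : d0.-tuple R -> 'cV[R]_d1) (w : nat -> nat -> R)
    (beta0 beta1 : 'cV[R]_d1) (gamma : R)
    (PX : probability (d0.-tuple R) R)
    (sigma : R) (sigma_ : bool -> R)
    (Pe : bool -> probability (measurableTypeR R) R)
    d (T : measurableType d) (P : probability T R)
    (x : nat -> {RV P >-> d0.-tuple R}) (a : nat -> {RV P >-> bool})
    (y e : nat -> {RV P >-> R}) : Prop := {
  phi_measurable : forall i, measurable_fun setT (fun v => phi v i 0);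
  context_intercept : exists i0 : 'I_d0, {ae PX, forall v, tnth v i0 = 1};
  context_iid : iid P PX x;
  rewardE : forall (t : nat) (om : T), (1 <= t)%N ->
    y t om = mean_reward phi w beta0 beta1 gamma (path_of x om) (path_of a om) t
             + e t om;
  reward_cond_mean : forall t : nat, (1 <= t)%N ->
    is_cond_mean P
      (events_of (x t) `|` events_of (fun om => kappa w (path_of a om) t)
       `|` events_of (a t))
      (y t)
      (fun om => mean_reward phi w beta0 beta1 gamma
                   (path_of x om) (path_of a om) t);
  (* given a_t, the noise e_t is independent of (x_t, H_{t-1}); conditional
     probabilities given {a_t = i} are multiplied out *)
  noise_cond_indep : forall (t : nat) (i : bool) (B : set R) (D : set T),
    (1 <= t)%N -> measurable B ->
    <<s hist_events x a y t.-1 `|` events_of (x t) >> D ->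
    (P (a t @^-1` [set i] `&` e t @^-1` B `&` D) * P (a t @^-1` [set i]) =
     P (a t @^-1` [set i] `&` e t @^-1` B) * P (a t @^-1` [set i] `&` D))%E;
  (* given a_t = i, the noise e_t has law Pe i *)
  noise_cond_law : forall (t : nat) (i : bool) (B : set R),
    (1 <= t)%N -> measurable B ->
    (P (a t @^-1` [set i] `&` e t @^-1` B) = P (a t @^-1` [set i]) * Pe i B)%E;
  sigma_gt0 : 0 < sigma;
  (* the laws of the noise given a_t = 0 and a_t = 1 are each sigma-subgaussian
     (hence so is their mixture, the unconditional law of e_t) *)
  noise_subgaussian : forall i, subgaussian sigma (Pe i);
  noise_variance : forall i,
    ('E_(Pe i)[fun r : measurableTypeR R => ((r : R) ^+ 2)%R] =
     (sigma_ i ^+ 2)%:E)%E;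
  noise_variance_lt : forall i, sigma_ i ^+ 2 < sigma ^+ 2
}.

(** ** The FRONT algorithm *)

(* [nforce], [warmT], [warmL] are the usual K, T_0, L. *)
Record front_inputs (R : realType) := FrontInputs {
  clipC : R;
  kappa0 : R;
  nforce : nat;
  warmT : nat;
  warmL : nat;
  eps : nat -> R
}.

Definition front_inputs_ok (R : realType) (I : front_inputs R) : Prop :=
  [/\ 0 < clipC I, (0 < warmL I)%N & forall t, (1 <= t)%N -> 0 <= eps I t <= 1].

Definition warm_arm1 (R : realType) (I : front_inputs R) (t : nat) : Prop :=
  exists i : nat, [/\ (1 <= i <= warmL I)%N,
    (i%:R - 1) * (warmT I)%:R / (warmL I)%:R < t%:R :> R &
    t%:R <= (2 * i%:R - 1) * (warmT I)%:R / (2 * (warmL I)%:R) :> R].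

Definition warm_arm0 (R : realType) (I : front_inputs R) (t : nat) : Prop :=
  exists i : nat, [/\ (1 <= i <= warmL I)%N,
    (2 * i%:R - 1) * (warmT I)%:R / (2 * (warmL I)%:R) < t%:R :> R &
    t%:R <= i%:R * (warmT I)%:R / (warmL I)%:R :> R].

Definition pihat (R : realType) (d0 d1 : nat) (phi : d0.-tuple R -> 'cV[R]_d1)
    (w : nat -> nat -> R) (I : front_inputs R)
    (x : nat -> d0.-tuple R) (a : nat -> bool) (y : nat -> R) (t : nat) : R :=
  let th := estimator (zvec phi w x a) y t.-1 in
  (1 - eps I t) *
    (0 <= ((phi (x t))^T *m (est_beta1 th - est_beta0 th)) 0 0
          + zeta w t * est_gamma th)%R%:R
  + eps I t / 2.

(* [S s] tells whether a round of force pulls begins at time s, fixing the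
   actions at times s, s+1, ..., s+K; [fixed K S t] tells whether the action at
   time t has been fixed by a round begun strictly before t. *)
Definition fixed (K : nat) (S : nat -> bool) (t : nat) : bool :=
  [exists s : 'I_t, S s && (t <= s + K)%N].

(* [b t] is the action drawn at time t, before a possible force pull replaces
   it; [a t] is the action finally taken.  By convention [b t] is [a t] at the
   times where nothing is drawn (warm-up, and actions already fixed). *)
Record front_run (R : realType) (d0 d1 : nat)
    (phi : d0.-tuple R -> 'cV[R]_d1) (w : nat -> nat -> R)
    (I : front_inputs R)
    d (T : measurableType d) (P : probability T R)
    (x : nat -> {RV P >-> d0.-tuple R}) (a b : nat -> {RV P >-> bool})
    (y : nat -> {RV P >-> R}) (S : nat -> T -> bool) : Prop := {
  front_warm1 : forall (t : nat) (om : T),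
    (1 <= t <= warmT I)%N -> warm_arm1 I t -> a t om = true;
  front_warm0 : forall (t : nat) (om : T),
    (1 <= t <= warmT I)%N -> warm_arm0 I t -> a t om = false;
  (* Conditionally on x_t, H_{t-1} and the earlier draws (which determine whether
     a_t is already fixed), b_t is Bernoulli(pihat_t).  Nothing is prescribed
     where the estimator at time t-1 is undefined. *)
  front_draw : forall (t : nat) (D : set T),
    (warmT I < t)%N ->
    <<s hist_events x a y t.-1 `|` events_of (x t)
        `|` \bigcup_(s in [set s | (1 <= s < t)%N]) events_of (b s) >> D ->
    (forall om, D om ->
       ~~ fixed (nforce I) (path_of S om) t &&
       (gram (zvec phi w (path_of x om) (path_of a om)) t.-1 \in unitmx)) ->
    (P (D `&` b t @^-1` [set true]) =
     \int[P]_(om in D)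
       (pihat phi w I (path_of x om) (path_of a om) (path_of y om) t)%:E)%E;
  (* the eigenvalue test uses the drawn action at time t *)
  front_test : forall (t : nat) (om : T),
    S t om =
    [&& (warmT I < t)%N, ~~ fixed (nforce I) (path_of S om) t &
        lambda_min (gram (zvec phi w (path_of x om)
          (fun s => if s == t then b s om else a s om)) t)
        <= clipC I * eps I t];
  front_force : forall (s t : nat) (om : T),
    S s om -> (s <= t <= s + nforce I)%N ->
    a t om = (kappa w (path_of a om) s <= kappa0 I);
  front_keep : forall (t : nat) (om : T), ~~ S t om -> a t om = b t om
}.

(** ** Assumptions *)

Record boundedness (R : realType) (d0 d1 : nat)
    (phi : d0.-tuple R -> 'cV[R]_d1) (w : nat -> nat -> R)
    (PX : probability (d0.-tuple R) R) (Lx lam Lz : R) : Prop := {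
  Lx_gt0 : 0 < Lx;
  lam_gt0 : 0 < lam;
  (* the norm on matrices is the entrywise sup norm *)
  phi_bounded : {ae PX, forall v, `|phi v| <= Lx};
  phi_covariance : lam < lambda_min
    (\matrix_(i < d1, j < d1) fine ('E_PX[fun v => (phi v i 0 * phi v j 0)%R])%E);
  Lx_le_Lz : Lx <= Lz;
  w_bounded : forall t : nat, (1 <= t)%N -> \sum_(1 <= s < t) `|w t s| <= Lz
}.

(* Clipping at the single time step t.  At t = 1 the matrix has rank at most 1,
   so its smallest eigenvalue is 0 and the condition fails as soon as C > 0:
   required at every t >= 1 it could never hold. *)
Definition clipping_at (R : realType) (d0 d1 : nat)
    (phi : d0.-tuple R -> 'cV[R]_d1) (w : nat -> nat -> R)
    (I : front_inputs R)
    d (T : measurableType d) (P : probability T R)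
    (x : nat -> {RV P >-> d0.-tuple R}) (a : nat -> {RV P >-> bool})
    (t : nat) : Prop :=
  {ae P, forall om, clipC I * eps I t <
     lambda_min (gram (zvec phi w (path_of x om) (path_of a om)) t)}.

(* Main.v *)
(* The estimation error solves G (theta_hat - theta) = (1/t) sum_s e_s z_s, where G
   is the empirical Gram matrix.  Since v^T G v >= lambda_min(G) |v|_2^2, one has
   lambda_min(G) |v|_1 <= d max_j |(G v)_j|, so on the clipping event an l1 error
   above h forces one of the d = 2 d_1 + 1 sums sum_s z_{s,j} e_s to exceed
   tau = t h C eps_t / d in absolute value.  Given a_s, the noise e_s is independent
   of x_s and of the history, while z_s is a function of a_s, x_s and the history:
   each sum is a martingale with conditionally subgaussian increments of variance
   proxy L_z^2 sigma^2.  The Chernoff bound and a union bound over j give the failure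
   probability 2 d exp(- tau^2 / (2 t L_z^2 sigma^2)), which is at most the claimed
   one because 2 d = 4 d_1 + 2. *)
Require Import Defs.
From HB Require Import structures.
From mathcomp Require Import all_boot all_order all_algebra.
From mathcomp Require Import all_classical all_reals all_analysis.
From mathcomp Require Import measurable_realfun ring lra.

Set Implicit Arguments.
Unset Strict Implicit.
Unset Printing Implicit Defensive.
Import Order.TTheory GRing.Theory Num.Theory.
Import numFieldNormedType.Exports.

Local Open Scope classical_set_scope.
Local Open Scope ring_scope.

(** * Rayleigh quotients and the smallest eigenvalue of a symmetric matrix *)

Lemma quad_continuous (R : realType) n (A : 'M[R]_n) :
  continuous (fun v : 'rV[R]_n => (v *m A *m v^T) 0 0).
Proof.
have -> : (fun v : 'rV[R]_n => (v *m A *m v^T) 0 0) =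
    (fun v => \sum_j (\sum_i v 0 i * A i j) * v 0 j).
  by apply/funext => v; rewrite mxE; apply: eq_bigr => j _; rewrite !mxE.
move=> v; apply: (@cvg_big _ _ _ _ _ _ _ (nbhs v)) => [|j _]; first exact: add_continuous.
apply: cvgM; last exact: coord_continuous.
apply: (@cvg_big _ _ _ _ _ _ _ (nbhs v)) => [|i _]; first exact: add_continuous.
by apply: cvgM; [exact: coord_continuous | exact: cvg_cst].
Qed.

Lemma row_dotE (R : realType) n (v : 'rV[R]_n) :
  (v *m v^T) 0 0 = \sum_i v 0 i ^+ 2.
Proof. by rewrite mxE; apply: eq_bigr => i _; rewrite mxE. Qed.

Lemma row_dot_ge0 (R : realType) n (v : 'rV[R]_n) : 0 <= (v *m v^T) 0 0.
Proof. by rewrite row_dotE sumr_ge0// => i _; exact: sqr_ge0. Qed.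

Lemma row_dot_eq0 (R : realType) n (v : 'rV[R]_n) :
  ((v *m v^T) 0 0 == 0) = (v == 0).
Proof.
rewrite row_dotE psumr_eq0 => [|i _]; last exact: sqr_ge0.
apply/allP/eqP => [v0|-> i _]; last by rewrite mxE expr0n/= eqxx.
by apply/rowP => i; rewrite mxE; apply/eqP; rewrite -sqrf_eq0; exact: (v0 i (mem_index_enum i)).
Qed.

Lemma unit_sphere_compact (R : realType) n :
  compact [set v : 'rV[R]_n | (v *m v^T) 0 0 = 1].
Proof.
apply: bounded_closed_compact.
  exists 1; split => // M M1 v /= v1; apply: ltW; apply: le_lt_trans M1.
  rewrite [leLHS]/Num.norm /= mx_normrE; apply/bigmax_leP; split => // -[i j] _ /=.
  rewrite ord1 -(ler_pXn2r (n := 2)) ?nnegrE// expr1n real_normK ?num_real//.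
  rewrite -v1 row_dotE (bigD1 j)//= lerDl sumr_ge0// => k _; exact: sqr_ge0.
have -> : [set v : 'rV[R]_n | (v *m v^T) 0 0 = 1] =
    (fun v : 'rV[R]_n => (v *m 1%:M *m v^T) 0 0) @^-1` [set 1].
  by apply/seteqP; split => v /=; rewrite mulmx1.
apply: closed_comp; last exact: closed_eq.
by move=> v _; exact: quad_continuous.
Qed.

(* The eigenvector is a minimizer of the Rayleigh quotient on the unit sphere. *)
Lemma rayleigh_eigenvalue (R : realType) n (A : 'M[R]_n.+1) : A^T = A ->
  exists2 mu, eigenvalue A mu &
    forall v : 'rV_n.+1, mu * (v *m v^T) 0 0 <= (v *m A *m v^T) 0 0.
Proof.
move=> As.
pose q (v : 'rV[R]_n.+1) : R := (v *m A *m v^T) 0 0.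
have [||c] := @EVT_min_rV R _ q _ _ (@unit_sphere_compact R n.+1).
- exists (delta_mx 0 0) => /=; by rewrite trmx_delta mul_delta_mx mxE !eqxx.
- by apply: continuous_subspaceT; exact: quad_continuous.
rewrite inE /= => c1 cmin.
(* The bound at the minimizer on the unit sphere extends to all [v] because [q] is homogeneous of
   degree 2: normalize by [Num.sqrt s]. *)
have qge v : q c * (v *m v^T) 0 0 <= q v.
  have [->|v0] := eqVneq v 0; first by rewrite [q 0]/q !mul0mx !mxE mulr0.
  have s0 : 0 < (v *m v^T) 0 0 by rewrite lt_neqAle eq_sym row_dot_eq0 v0 row_dot_ge0.
  set s := (v *m v^T) 0 0 in s0 *.
  have /cmin : (Num.sqrt s)^-1 *: v \in [set v : 'rV[R]_n.+1 | (v *m v^T) 0 0 = 1].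
    rewrite inE /= linearZ/= -scalemxAl -scalemxAr scalerA mxE.
    by rewrite -/s -invfM -expr2 sqr_sqrtr ?(ltW s0)// mulVf// gt_eqF.
  rewrite {2}/q linearZ/= -!scalemxAl -scalemxAr scalerA mxE -/(q v).
  by rewrite -invfM -expr2 sqr_sqrtr ?(ltW s0)// mulrC ler_pdivlMr.
exists (q c); last exact: qge.
apply/eigenvalueP; exists c; last first.
  by apply: contra_eq_neq c1 => ->; rewrite mul0mx mxE eq_sym oner_neq0.
(* [B] is positive semidefinite and its form vanishes at [c]; the rest shows that this forces
   [c *m B = 0], so [c] is an eigenvector. *)
pose B := A - (q c)%:M.
have Bs : B^T = B by rewrite /B linearB/= As tr_scalar_mx.
have BE v : (v *m B *m v^T) 0 0 = q v - q c * (v *m v^T) 0 0.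
  by rewrite /B mulmxBr mulmxBl mul_mx_scalar -scalemxAl [LHS]mxE [X in _ + X]mxE [X in _ - X]mxE.
have Bge (v : 'rV_n.+1) : 0 <= (v *m B *m v^T) 0 0 by rewrite BE subr_ge0.
suff : c *m B == 0 by rewrite /B mulmxBr subr_eq0 mul_mx_scalar => /eqP.
clearbody B.
set w := c *m B; rewrite -row_dot_eq0.
set k := (w *m B *m w^T) 0 0; set m := (w *m w^T) 0 0.
have m0 : 0 <= m by exact: row_dot_ge0.
have k0 : 0 <= k by exact: Bge.
(* The form of [B] along the line [c + s *: w] has no constant term, and its linear term has slope
   [2 * m]. *)
have expand s : 0 <= 2 * s * m + s ^+ 2 * k.
  have := Bge (c + s *: w).
  suff -> : ((c + s *: w) *m B *m (c + s *: w)^T) 0 0 = 2 * s * m + s ^+ 2 * k by [].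
  have cBc : (c *m B *m c^T) 0 0 = 0 by rewrite BE c1 mulr1 subrr.
  have wBc : (w *m B *m c^T) 0 0 = m.
    have -> : w *m B *m c^T = (c *m B *m w^T)^T
      by rewrite [RHS]trmx_mul trmxK [(c *m B)^T]trmx_mul Bs mulmxA.
    by rewrite mxE.
  have -> : (c + s *: w)^T = c^T + s *: w^T by apply/colP => i; rewrite !mxE.
  rewrite !mulmxDr !mulmxDl -!scalemxAl -!scalemxAr.
  have e i : forall (M N : 'M[R]_1), (M + N) i i = M i i + N i i by move=> M N; rewrite mxE.
  have e' i : forall a (M : 'M[R]_1), (a *: M) i i = a * M i i by move=> a M; rewrite mxE.
  by rewrite !e !e' cBc wBc -/w -/k -/m; ring.
rewrite eq_le m0 andbT leNgt; apply/negP => m1.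
(* A small negative [s] makes the linear term win if [m > 0]; the [+ 1] keeps the denominator
   positive even when [k = 0]. *)
have := expand (- m / (k + 1)); apply/negP; rewrite -ltNge.
have k1 : 0 < k + 1 by lra.
have -> : 2 * (- m / (k + 1)) * m + (- m / (k + 1)) ^+ 2 * k =
  - (m / (k + 1)) ^+ 2 * (k + 2).
  by field; rewrite gt_eqF.
by rewrite mulNr oppr_lt0 mulr_gt0 ?exprn_gt0 ?divr_gt0//; lra.
Qed.

(** The value [mu] from [rayleigh_eigenvalue], tested on an eigenvector for [l], gives [mu <= l]. So
    [mu] is a lower bound of the set of eigenvalues and belongs to it, whence the infimum is at most
    [mu]. In dimension 0 both sides vanish. *)
Lemma lambda_min_rayleigh (R : realType) n (A : 'M[R]_n) (v : 'rV_n) : A^T = A ->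
  lambda_min A * (v *m v^T) 0 0 <= (v *m A *m v^T) 0 0.
Proof.
case: n => [|n] in A v * => As.
  by rewrite (thinmx0 v) !mul0mx mxE mulr0.
have [mu muA muP] := rayleigh_eigenvalue As.
apply: le_trans (muP v); rewrite ler_wpM2r ?row_dot_ge0//.
apply: ge_inf => //; exists mu => l /= /eigenvalueP[u uA u0].
have := muP u; rewrite uA -scalemxAl [leRHS]mxE ler_pM2r//.
by rewrite lt_neqAle eq_sym row_dot_eq0 u0 row_dot_ge0.
Qed.

(** Cauchy-Schwarz against the all-ones vector: both sides become double sums over [i] and [j],
    compared term by term through [2ab <= a^2 + b^2]. *)
Lemma l1norm_sqr_le (R : realType) n (v : 'cV[R]_n) :
  l1norm v ^+ 2 <= n%:R * \sum_i v i 0 ^+ 2.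
Proof.
rewrite /l1norm expr2 mulr_suml.
under eq_bigr do rewrite mulr_sumr.
set S := \sum_i v i 0 ^+ 2.
have -> : n%:R * S = \sum_i \sum_j (v i 0 ^+ 2 + v j 0 ^+ 2) / 2.
  have inner i : \sum_j (v i 0 ^+ 2 + v j 0 ^+ 2) / 2 = (n%:R * v i 0 ^+ 2 + S) / 2.
    by rewrite -mulr_suml big_split/= sumr_const card_ord -[_ *+ n]mulr_natl.
  under [RHS]eq_bigr do rewrite inner.
  rewrite -mulr_suml big_split/= -mulr_sumr sumr_const card_ord -/S -[_ *+ n]mulr_natl.
  by field.
apply: ler_sum => i _; apply: ler_sum => j _.
rewrite -[v i 0 ^+ 2]real_normK ?num_real// -[v j 0 ^+ 2]real_normK ?num_real//.
by have := sqr_ge0 (`|v i 0| - `|v j 0|); lra.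
Qed.

(** A kernel vector has zero quadratic form, so the Rayleigh bound forces its Euclidean norm to
    vanish. *)
Lemma lambda_min_gt0_unitmx (R : realType) n (A : 'M[R]_n) : A^T = A ->
  0 < lambda_min A -> A \in unitmx.
Proof.
move=> As l0; rewrite -row_free_unit -kermx_eq0; apply/eqP/row_matrixP => i.
rewrite row0; apply/eqP; rewrite -row_dot_eq0.
set v := row i _.
have vA : v *m A = 0 by apply/sub_kermxP; exact: row_sub.
have := lambda_min_rayleigh v As; rewrite vA mul0mx [leRHS]mxE pmulr_rle0// => v0.
by rewrite eq_le v0 row_dot_ge0.
Qed.

(** With [l = lambda_min A]: [l |v|_1^2 <= n l |v|_2^2 <= n v^T A v <= n delta |v|_1]; then divide
    by [|v|_1]. *)
Lemma l1norm_lambda_min (R : realType) n (A : 'M[R]_n) (v : 'cV_n) (delta : R) :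
  A^T = A -> 0 <= delta -> (forall i, `|(A *m v) i 0| <= delta) ->
  0 <= lambda_min A -> lambda_min A * l1norm v <= n%:R * delta.
Proof.
move=> As d0 Av l0.
have v0 : 0 <= l1norm v by rewrite sumr_ge0.
have [->|vn0] := eqVneq (l1norm v) 0; first by rewrite mulr0 mulr_ge0.
have {vn0}v0 : 0 < l1norm v by rewrite lt_neqAle eq_sym vn0.
rewrite -(ler_pM2r v0) -mulrA -expr2.
apply: (le_trans (ler_wpM2l l0 (l1norm_sqr_le v))).
rewrite mulrCA -mulrA ler_wpM2l//.
have := lambda_min_rayleigh v^T As; rewrite row_dotE trmxK -mulmxA.
under eq_bigr do rewrite mxE.
move=> /le_trans; apply; rewrite mxE mulr_sumr ler_sum// => i _.
by rewrite mxE (le_trans (ler_norm _))// normrM mulrC ler_wpM2r.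
Qed.

(** * Conditionally subgaussian sums: exponential moments and tails *)

(** Bundles the law of [X] as a finite measure, so that it can be a factor of a product measure. *)
Lemma finite_pushforward d d' (T : measurableType d) (U : measurableType d')
    (R : realType) (m : {finite_measure set T -> \bar R}) (X : T -> U) :
  measurable_fun setT X ->
  exists m' : {finite_measure set U -> \bar R}, m' = pushforward m X :> (set U -> \bar R).
Proof.
move=> mX.
have [m1 m1E] : exists m1 : {measure set U -> \bar R},
    m1 = pushforward m X :> (set U -> \bar R).
  by unshelve eexists (pushforward m X : {measure set U -> \bar R}); first exact mX.
have m1oo : (m1 setT < +oo)%E.
  by rewrite m1E /pushforward preimage_setT -ge0_fin_numE// fin_num_measure.
by exists (mfrestr measurableT m1oo); apply/funext => B; rewrite /= /mfrestr /mrestr setIT m1E.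
Qed.

(* The joint law of (X, e) is a product measure, so this is Tonelli's theorem. *)
Lemma ge0_integral_indep_pair d d1 d2 (T : measurableType d)
    (U : measurableType d1) (V : measurableType d2) (R : realType)
    (m : {finite_measure set T -> \bar R}) (Q : probability V R)
    (X : T -> U) (e : T -> V) (f : U * V -> \bar R) :
  measurable_fun setT X -> measurable_fun setT e ->
  (forall A B, measurable A -> measurable B ->
     m (X @^-1` A `&` e @^-1` B) = (m (X @^-1` A) * Q B)%E) ->
  measurable_fun [set: U * V] f -> (forall z, 0 <= f z)%E ->
  (\int[m]_om f (X om, e om) = \int[m]_om \int[Q]_r f (X om, r))%E.
Proof.
move=> mX me indep mf f0.
have mXe : measurable_fun setT (fun om => (X om, e om)).
  exact: measurable_fun_pair.
have [mX' mX'E] := finite_pushforward m mX.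
have [mXe' mXe'E] := finite_pushforward m mXe.
transitivity (\int[mXe']_z f z)%E.
  by rewrite mXe'E (ge0_integral_pushforward mXe)//= preimage_setT.
transitivity (\int[mX' \x Q]_z f z)%E.
  apply: eq_measure_integral => B mB _; apply/esym.
  apply: product_measure_unique mB => A C mA mC.
  change (mXe' (A `*` C) = mX' A * Q C)%E.
  by rewrite mX'E mXe'E /pushforward -indep.
transitivity (\int[mX']_z \int[Q]_r f (z, r))%E; first exact: fubini_tonelli1.
rewrite mX'E (ge0_integral_pushforward mX)//=.
- exact: measurable_fun_fubini_tonelli_F.
- by move=> z _; exact: integral_ge0.
Qed.

(** Conditioning on the action without dividing by its probability: the restrictions of [P] to the
    two events [a = i] add up to [P], and on each the integrand is [F i] almost everywhere. *)
Lemma ge0_integral_split_bool d (T : measurableType d) (R : realType)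
    (P : probability T R) (a : T -> bool) (F : bool -> T -> \bar R)
    (ma : forall i, measurable (a @^-1` [set i])) :
  (forall i, measurable_fun setT (F i)) -> (forall i om, 0 <= F i om)%E ->
  (\int[P]_om F (a om) om = \int[mrestr P (ma true)]_om F true om
                          + \int[mrestr P (ma false)]_om F false om)%E.
Proof.
move=> mF F0.
have mFa : measurable_fun setT (fun om => F (a om) om).
  have -> : (fun om => F (a om) om) = (fun om => if a om then F true om else F false om).
    by apply/funext => om; case: (a om).
  apply: measurable_fun_ifT => //.
  by apply: (measurable_fun_bool true); rewrite setTI.
have restrE i : (\int[mrestr P (ma i)]_om F (a om) om = \int[mrestr P (ma i)]_om F i om)%E.
  apply: ge0_ae_eq_integral => //.
  exists (~` (a @^-1` [set i])); split.
  - exact: measurableC.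
  - by rewrite /= /mrestr setICl measure0.
  - by move=> om /= H1 H2; apply: H1 => _; rewrite H2.
rewrite -!restrE -ge0_integral_measure_add//.
apply: eq_measure_integral => B mB _.
transitivity (mrestr P (ma true) B + mrestr P (ma false) B)%E; last exact/esym/measure_addE.
rewrite /mrestr -measureU; [|exact: measurableI|exact: measurableI|].
  rewrite -setIUr; congr (P _); apply/seteqP; split => om /=; last by case.
  by move=> Bom; split => //; case: (a om); [left|right].
by apply/seteqP; split => om //= -[[_ ->] [_]].
Qed.

(** One step of the exponential supermartingale. Under [P] restricted to [a = i], the noise is
    independent of the past with law [Q i], so it can be integrated out with the past frozen. The
    inner integral is the moment generating function of [Q i] at [u * Z i om], and [Z i om] is
    bounded by [L]. *)
Lemma subgaussian_mgf_step d (T : measurableType d) (R : realType)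
    (P : probability T R) (G : set (set T))
    (Q : bool -> probability (measurableTypeR R) R)
    (a : T -> bool) (e : T -> measurableTypeR R)
    (M : T -> R) (Z : bool -> T -> R) (sigma L u : R) :
  <<s G >> `<=` measurable ->
  (forall i, measurable (a @^-1` [set i])) -> measurable_fun setT e ->
  (forall i, subgaussian sigma (Q i)) ->
  (forall i D B, <<s G >> D -> measurable B ->
     P (a @^-1` [set i] `&` e @^-1` B `&` D) = (P (a @^-1` [set i] `&` D) * Q i B)%E) ->
  measurable_fun setT (M : g_sigma_algebraType G -> R) -> (forall om, 0 <= M om) ->
  (forall i, measurable_fun setT (Z i : g_sigma_algebraType G -> R)) ->
  (forall i om, `|Z i om| <= L) ->
  (\int[P]_om (M om * expR (u * (Z (a om) om * e om)))%:E <=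
   (expR (u ^+ 2 * L ^+ 2 * sigma ^+ 2 / 2))%:E * \int[P]_om (M om)%:E)%E.
Proof.
move=> mG ma me subQ indep mM M0 mZ ZL.
(* [U] is [T] with the sigma-algebra of the past; the identity from [T] to [U] is the random
   variable that stands for the past. *)
pose U := g_sigma_algebraType G.
have mid : measurable_fun setT (idfun : T -> U).
  by move=> _ B mB; rewrite setTI; exact: mG.
have mM' : measurable_fun setT M by exact: (measurableT_comp mM mid).
have mZ' i : measurable_fun setT (Z i) by exact: (measurableT_comp (mZ i) mid).
have me' : measurable_fun setT (e : T -> R) by exact: me.
pose f i (z : U * measurableTypeR R) : \bar R :=
  (M z.1 * expR (u * (Z i z.1 * z.2)))%:E.
have mf i : measurable_fun [set: U * measurableTypeR R] (f i).
  apply/measurable_EFinP; apply: measurable_funM.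
    exact: (measurableT_comp mM measurable_fst).
  apply: measurableT_comp => //; apply: measurable_funM => //; apply: measurable_funM.
    exact: (measurableT_comp (mZ i) measurable_fst).
  exact: measurable_snd.
have f0 i z : (0 <= f i z)%E by rewrite lee_fin mulr_ge0 ?expR_ge0.
have := @ge0_integral_split_bool _ _ _ P a (fun i om => f i (om, e om)) ma.
move=> ->; first last.
- by move=> i om; exact: f0.
- move=> i; apply: (measurableT_comp (mf i)).
  exact: (measurable_fun_pair mid me).
have := @ge0_integral_split_bool _ _ _ P a (fun=> EFin \o M) ma.
move=> ->; first last.
- by move=> i om; rewrite lee_fin.
- by move=> i; exact/measurable_EFinP.
rewrite ge0_muleDr ?integral_ge0//; [|by move=> om _; rewrite lee_fin..].
suff step i : (\int[mrestr P (ma i)]_om f i (om, e om) <=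
    (expR (u ^+ 2 * L ^+ 2 * sigma ^+ 2 / 2))%:E
    * \int[mrestr P (ma i)]_om (EFin \o M) om)%E by exact: leeD.
have indep' A B : measurable A -> measurable B ->
    mrestr P (ma i) ((idfun : T -> U) @^-1` A `&` e @^-1` B) =
    (mrestr P (ma i) ((idfun : T -> U) @^-1` A) * Q i B)%E.
  move=> mA mB; rewrite /mrestr setIC [in RHS]setIC -indep//.
  by congr (P _); rewrite -setIA [e @^-1` B `&` _]setIC.
have -> := @ge0_integral_indep_pair _ _ _ T U _ R (mrestr P (ma i)) (Q i) idfun e (f i)
  mid me indep' (mf i) (f0 i).
rewrite -ge0_integralZl//; last 2 first.
- exact/measurable_EFinP.
- by move=> om _; rewrite lee_fin.
apply: ge0_le_integral => //.
- by move=> om _; apply: integral_ge0 => r _; exact: f0.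
- have mF : measurable_fun [set: U] (fubini_F (Q i) (f i)).
    exact: measurable_fun_fubini_tonelli_F.
  have mc := measurableT_comp mF mid; exact mc.
- by apply: measurable_funeM; exact/measurable_EFinP.
move=> om _ /=; rewrite /f /=.
under eq_integral do rewrite EFinM.
rewrite ge0_integralZl//; first last.
- by rewrite lee_fin.
- apply/measurable_EFinP; apply: measurableT_comp => //.
  by do 2 apply: measurable_funM => //.
rewrite muleC lee_wpmul2r ?lee_fin//.
have := subQ i (u * Z i om); rewrite /mmt_gen_fun unlock => sub.
apply: (@le_trans _ _ (expR ((u * Z i om) ^+ 2 * sigma ^+ 2 / 2))%:E).
  apply: le_trans sub; rewrite le_eqVlt; apply/orP; left; apply/eqP.
  by apply: eq_integral => r _ /=; rewrite mulrA mulrC.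
rewrite lee_fin ler_expR ler_wpM2r// ler_wpM2r ?sqr_ge0// exprMn ler_wpM2l ?sqr_ge0//.
by rewrite -real_normK ?num_real// ler_pXn2r// nnegrE (le_trans _ (ZL i om)).
Qed.
(** Induction on [n]: the exponential of the first [n] terms is known at time [n + 1] and serves as
    the factor [M] of [subgaussian_mgf_step], so each term costs one factor. *)
Lemma subgaussian_sum_mgf d (T : measurableType d) (R : realType)
    (P : probability T R) (G : nat -> set (set T))
    (Q : bool -> probability (measurableTypeR R) R)
    (a : nat -> T -> bool) (e : nat -> T -> R) (Z : nat -> bool -> T -> R)
    (sigma L : R) (n : nat) (u : R) :
  (forall s, (1 <= s)%N -> <<s G s >> `<=` measurable) ->
  (forall s i, (1 <= s)%N -> measurable (a s @^-1` [set i])) ->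
  (forall s, (1 <= s)%N -> measurable_fun setT (e s)) ->
  (forall i, subgaussian sigma (Q i)) ->
  (forall s i D B, (1 <= s)%N -> <<s G s >> D -> measurable B ->
     P (a s @^-1` [set i] `&` e s @^-1` B `&` D) =
     (P (a s @^-1` [set i] `&` D) * Q i B)%E) ->
  (forall s i, (1 <= s)%N ->
     measurable_fun setT (Z s i : g_sigma_algebraType (G s) -> R)) ->
  (forall s i om, (1 <= s)%N -> `|Z s i om| <= L) ->
  (forall s, (1 <= s)%N ->
     measurable_fun setT ((fun om => \sum_(1 <= r < s) Z r (a r om) om * e r om)
       : g_sigma_algebraType (G s) -> R)) ->
  (\int[P]_om (expR (u * \sum_(1 <= s < n.+1) Z s (a s om) om * e s om))%:E <=
   (expR (n%:R * (u ^+ 2 * L ^+ 2 * sigma ^+ 2 / 2)))%:E)%E.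
Proof.
move=> mG ma me subQ indep mZ ZL msum.
elim: n => [|n ih].
  under eq_integral do rewrite big_geq// mulr0 expR0.
  by rewrite integral_cst// mul0r expR0 mul1e; exact: probability_le1.
under eq_integral do rewrite big_nat_recr//= mulrDr expRD.
have n1 : (1 <= n.+1)%N by [].
have mM : measurable_fun setT ((fun om =>
    expR (u * \sum_(1 <= r < n.+1) Z r (a r om) om * e r om))
      : g_sigma_algebraType (G n.+1) -> R).
  apply: measurableT_comp => //; apply: measurable_funM => //; exact: msum.
apply: (le_trans (@subgaussian_mgf_step _ _ _ P _ Q _ _ _ _ sigma L u
   (mG _ n1) (fun i => ma _ i n1) (me _ n1) subQ (fun i D B => indep _ i D B n1) mM
   (fun om => expR_ge0 _) (fun i => mZ _ i n1) (fun i om => ZL _ i om n1))).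
rewrite -[n.+1%:R]natr1 mulrDl mul1r expRD EFinM muleC lee_wpmul2r ?lee_fin ?expR_ge0//.
Qed.

(* Optimizing the Chernoff bound over u gives u = tau / v. *)
Lemma subgaussian_tail d (T : measurableType d) (R : realType)
    (P : probability T R) (f : T -> R) (v tau : R) :
  measurable_fun setT f -> 0 < v -> 0 < tau ->
  (forall u, (\int[P]_om (expR (u * f om))%:E <= (expR (v * u ^+ 2 / 2))%:E)%E) ->
  (P [set om | (tau <= `|f om|)%R] <= (2 * expR (- (tau ^+ 2 / (2 * v))))%:E)%E.
Proof.
move=> mf v0 tau0.
pose X : {RV P >-> R} := HB.pack f (isMeasurableFun.Build _ _ _ _ _ mf).
rewrite -[f]/(X : T -> R) => mgf.
(* The one-sided tail is stated for any [Y]: the bound on the exponential moments is even in [u], so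
   it serves for [X] and for its opposite. *)
have tail (Y : {RV P >-> R}) :
    (forall u, (\int[P]_om (expR (u * Y om))%:E <= (expR (v * u ^+ 2 / 2))%:E)%E) ->
    (P [set om | (tau <= Y om)%R] <= (expR (- (tau ^+ 2 / (2 * v))))%:E)%E.
  move=> mgfY; have u0 : 0 < tau / v by rewrite divr_gt0.
  apply: (le_trans (chernoff Y tau u0)).
  have -> : - (tau ^+ 2 / (2 * v)) = v * (tau / v) ^+ 2 / 2 + - (tau / v * tau).
    by field; rewrite gt_eqF.
  rewrite expRD EFinM lee_wpmul2r ?lee_fin ?expR_ge0//.
  apply: le_trans (mgfY _); rewrite /mmt_gen_fun unlock le_eqVlt; apply/orP; left; apply/eqP.
  by apply: eq_integral => om _ /=; rewrite mulrC.
have mset (Y : {RV P >-> R}) : measurable [set om | (tau <= Y om)%R].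
  by rewrite -[X in measurable X]setTI; exact: measurable_fun_le.
apply: (@le_trans _ _ (P ([set om | (tau <= X om)%R] `|` [set om | (tau <= (\- X) om)%R]))).
  apply: le_measure; rewrite ?inE.
  - by rewrite -[X in measurable X]setTI; apply: measurable_fun_le => //; exact: measurableT_comp.
  - by apply: measurableU; [exact: mset|exact: (mset (\- X))].
  - move=> om /=; rewrite ler_normr => /orP[]; [by left|by right].
apply: (le_trans (measureU2 _ _ _)); first exact: mset.
  exact: (mset (\- X)).
rewrite mulr_natl mulr2n EFinD; apply: leeD; first exact: tail.
apply: (tail (\- X)) => u /=.
under eq_integral do rewrite mulrN -mulNr.
by rewrite -(sqrrN u); exact: mgf.
Qed.

(** * The estimation error and the bound on the features *)

Lemma gram_sym (R : realType) n (z : nat -> 'cV[R]_n) t : (gram z t)^T = gram z t.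
Proof.
rewrite /gram linearZ/= raddf_sum/=; congr (_ *: _).
by apply: eq_bigr => s _; rewrite trmx_mul trmxK.
Qed.

(** The Gram matrix cancels its inverse in the estimator, and the signal part [z s (z s)^T th] of
    [y s *: z s] is exactly what [gram z t *m th] subtracts. *)
Lemma gram_estimator_error (R : realType) n (z : nat -> 'cV[R]_n) (y e : nat -> R)
    (th : 'cV[R]_n) t :
  gram z t \in unitmx ->
  (forall s, (1 <= s)%N -> y s = ((z s)^T *m th) 0 0 + e s) ->
  gram z t *m (estimator z y t - th) = t%:R^-1 *: \sum_(1 <= s < t.+1) e s *: z s.
Proof.
move=> gU yE; rewrite /estimator mulmxBr mulKVmx// /gram -scalemxAl -scalerBr.
congr (_ *: _); rewrite mulmx_suml -sumrB; apply: eq_big_nat => s /andP[s1 _].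
rewrite yE// scalerDl -mulmxA [X in _ - z s *m X]mx11_scalar mul_mx_scalar.
by rewrite addrAC subrr add0r.
Qed.

Lemma mean_rewardE (R : realType) (d0 d1 : nat) (phi : d0.-tuple R -> 'cV[R]_d1)
    (w : nat -> nat -> R) (beta0 beta1 : 'cV[R]_d1) (gamma : R)
    (x : nat -> d0.-tuple R) (a : nat -> bool) t :
  mean_reward phi w beta0 beta1 gamma x a t =
  ((zvec phi w x a t)^T *m theta beta0 beta1 gamma) 0 0.
Proof.
rewrite /zvec /theta /mean_reward !tr_col_mx !mul_row_col tr_scalar_mx mul_mx_scalar.
have tZ c (v : 'cV[R]_d1) : (c *: v)^T = c *: v^T by apply/rowP => i; rewrite !mxE.
rewrite !tZ -!scalemxAl.
have DE (A B : 'M[R]_1) : (A + B) 0 0 = A 0 0 + B 0 0 by rewrite mxE.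
have ZE c (A : 'M[R]_1) : (c *: A) 0 0 = c * A 0 0 by rewrite mxE.
by rewrite !DE !ZE [_%:M 0 0]mxE eqxx mulr1n [gamma * _]mulrC.
Qed.

Lemma kappa_le (R : realType) (w : nat -> nat -> R) (a : nat -> bool) t (L : R) :
  \sum_(1 <= s < t) `|w t s| <= L -> `|kappa w a t| <= L.
Proof.
apply: le_trans; apply: (le_trans (ler_norm_sum _ _ _)).
apply: ler_sum => s _; rewrite normrM; case: (a s); first by rewrite normr1 mulr1.
by rewrite normr0 mulr0.
Qed.

Lemma zvec_le (R : realType) (d0 d1 : nat) (phi : d0.-tuple R -> 'cV[R]_d1)
    (w : nat -> nat -> R) (x : nat -> d0.-tuple R) (a : nat -> bool) t (Lx L : R) :
  `|phi (x t)| <= Lx -> Lx <= L -> \sum_(1 <= s < t) `|w t s| <= L ->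
  forall j, `|zvec phi w x a t j 0| <= L.
Proof.
move=> phiL LxL wL j.
have pL i : `|phi (x t) i 0| <= L.
  apply: le_trans LxL; apply: le_trans phiL.
  by rewrite [leRHS]/Num.norm /= mx_normrE; apply/bigmax_geP; right; exists (i, 0).
have L0 : 0 <= L by apply: le_trans wL; rewrite sumr_ge0.
rewrite /zvec mxE; case: splitP => i _; last first.
  by rewrite mxE ord1 eqxx mulr1n; exact: kappa_le.
rewrite mxE; case: splitP => k _; rewrite mxE; case: (a t) => /=.
- by rewrite subrr mul0r normr0.
- by rewrite subr0 mul1r.
- by rewrite mul1r.
- by rewrite mul0r normr0.
Qed.

(** * Measurability of sums, inverses and matrix-valued maps *)

Lemma measurable_sum_nat d (T : measurableType d) (R : realType) m n
    (h : nat -> T -> R) :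
  (forall i, (m <= i < n)%N -> measurable_fun setT (h i)) ->
  measurable_fun setT (fun om => \sum_(m <= i < n) h i om).
Proof.
elim: n => [|n ih] mh.
  have -> : (fun om => \sum_(m <= i < 0) h i om) = cst 0.
    by apply/funext => om; rewrite big_geq.
  exact: measurable_cst.
have [mn|nm] := leqP m n.
  have -> : (fun om => \sum_(m <= i < n.+1) h i om) =
      (fun om => \sum_(m <= i < n) h i om + h n om).
    by apply/funext => om; rewrite big_nat_recr.
  apply: measurable_funD; last by apply: mh; rewrite mn ltnS leqnn.
  by apply: ih => i /andP[mi im]; apply: mh; rewrite mi (ltn_trans im).
have -> : (fun om => \sum_(m <= i < n.+1) h i om) = cst 0.
  by apply/funext => om; rewrite big_geq.
exact: measurable_cst.
Qed.

(** [1/r = r (r^2)^(-1)] reduces inversion to a real power of a nonnegative number; at [r = 0] both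
    sides are 0 by convention. *)
Lemma measurable_inv d (T : measurableType d) (R : realType) (f : T -> R) :
  measurable_fun setT f -> measurable_fun setT (fun om => (f om)^-1).
Proof.
move=> mf.
have -> : (fun om => (f om)^-1) = (fun om => f om * ((f om ^+ 2) `^ (-1))).
  apply/funext => om; rewrite powR_inv1 ?sqr_ge0//.
  have [->|f0] := eqVneq (f om) 0; first by rewrite mul0r invr0.
  by field.
apply: measurable_funM => //; apply: (measurableT_comp (measurable_powR _)).
exact: measurable_funX.
Qed.

Section measurable_matrices.
Context d (T : measurableType d) (R : realType).

Definition mx_measurable m n (A : T -> 'M[R]_(m, n)) :=
  forall i j, measurable_fun setT (fun om => A om i j).

Lemma mx_measurable_mul m n p (A : T -> 'M[R]_(m, n)) (B : T -> 'M[R]_(n, p)) :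
  mx_measurable A -> mx_measurable B -> mx_measurable (fun om => A om *m B om).
Proof.
move=> mA mB i j.
have -> : (fun om => (A om *m B om) i j) = (fun om => \sum_k A om i k * B om k j).
  by apply/funext => om; rewrite mxE.
by apply: measurable_sum => k; exact: measurable_funM.
Qed.

Lemma mx_measurable_scale m n (c : T -> R) (A : T -> 'M[R]_(m, n)) :
  measurable_fun setT c -> mx_measurable A -> mx_measurable (fun om => c om *: A om).
Proof.
move=> mc mA i j.
have -> : (fun om => (c om *: A om) i j) = (fun om => c om * A om i j).
  by apply/funext => om; rewrite mxE.
exact: measurable_funM.
Qed.

Lemma mx_measurable_sum_nat m n p q (A : nat -> T -> 'M[R]_(m, n)) :
  (forall s, (p <= s < q)%N -> mx_measurable (A s)) ->
  mx_measurable (fun om => \sum_(p <= s < q) A s om).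
Proof.
move=> mA i j.
have -> : (fun om => (\sum_(p <= s < q) A s om) i j) =
    (fun om => \sum_(p <= s < q) A s om i j).
  by apply/funext => om; rewrite summxE.
by apply: measurable_sum_nat => s pq; exact: mA.
Qed.

Lemma mx_measurable_trmx m n (A : T -> 'M[R]_(m, n)) :
  mx_measurable A -> mx_measurable (fun om => (A om)^T).
Proof.
move=> mA i j.
have -> : (fun om => (A om)^T i j) = (fun om => A om j i).
  by apply/funext => om; rewrite mxE.
exact: mA.
Qed.

Lemma measurable_det n (A : T -> 'M[R]_n) :
  mx_measurable A -> measurable_fun setT (fun om => \det (A om)).
Proof.
move=> mA; apply: measurable_sum => s; apply: measurable_funM => //.
by apply: measurable_prod => i _; exact: mA.
Qed.

Lemma mx_measurable_invmx n (A : T -> 'M[R]_n) :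
  mx_measurable A -> mx_measurable (fun om => invmx (A om)).
Proof.
move=> mA i j.
have mdet := measurable_det mA.
(* Adjugate formula; on a singular matrix [invmx] returns the matrix itself. *)
have -> : (fun om => invmx (A om) i j) = (fun om =>
    if \det (A om) == 0 then A om i j else (\det (A om))^-1 * cofactor (A om) j i).
  apply/funext => om; rewrite /invmx unitmxE unitfE.
  by case: eqP => //= _; rewrite !mxE.
apply: measurable_fun_ifT => //.
- by apply: measurable_fun_eqr => //; exact: measurable_cst.
- apply: measurable_funM; first exact: measurable_inv.
  apply: measurable_funM => //; apply: measurable_det => k l.
  have -> : (fun om => row' j (col' i (A om)) k l) =
      (fun om => A om (lift j k) (lift i l)) by apply/funext => om; rewrite !mxE.
  exact: mA.
Qed.

Lemma measurable_l1norm n (v : T -> 'cV[R]_n) :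
  mx_measurable v -> measurable_fun setT (fun om => l1norm (v om)).
Proof.
move=> mv; apply: measurable_sum => i.
by apply: measurableT_comp => //; exact: mv.
Qed.

Lemma mx_measurable_estimator n (z : nat -> T -> 'cV[R]_n) (y : nat -> T -> R) t :
  (forall s, (1 <= s <= t)%N -> mx_measurable (z s)) ->
  (forall s, (1 <= s <= t)%N -> measurable_fun setT (y s)) ->
  mx_measurable (fun om => estimator (z ^~ om) (y ^~ om) t).
Proof.
move=> mz my; apply: mx_measurable_mul.
  apply: mx_measurable_invmx; apply: mx_measurable_scale => //.
  apply: mx_measurable_sum_nat => s st; apply: mx_measurable_mul; first exact: mz.
  by apply: mx_measurable_trmx; exact: mz.
apply: mx_measurable_scale => //.
apply: mx_measurable_sum_nat => s st; apply: mx_measurable_scale; first exact: my.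
exact: mz.
Qed.

Lemma measurable_bool_natr (b : T -> bool) :
  measurable_fun setT b -> measurable_fun setT (fun om => (b om)%:R : R).
Proof.
move=> mb.
have -> : (fun om => (b om)%:R : R) = (fun om => if b om then 1 else 0).
  by apply/funext => om; case: (b om).
by apply: measurable_fun_ifT.
Qed.

(** The sigma-algebra on [T] is arbitrary: the lemma serves both for the ambient one and for those
    generated by the past. *)
Lemma mx_measurable_zvec (d0 d1 : nat) (phi : d0.-tuple R -> 'cV[R]_d1)
    (w : nat -> nat -> R) (x : nat -> T -> d0.-tuple R) (a : nat -> T -> bool) t :
  (forall i, measurable_fun setT (fun v => phi v i 0)) ->
  measurable_fun setT (x t) ->
  (forall s, (1 <= s <= t)%N -> measurable_fun setT (a s)) -> (1 <= t)%N ->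
  mx_measurable (fun om => zvec phi w (x ^~ om) (a ^~ om) t).
Proof.
move=> mphi mx ma t1 j k; rewrite (ord1 k).
have mat : measurable_fun setT (fun om => (a t om)%:R : R).
  by apply: measurable_bool_natr; apply: ma; rewrite t1 leqnn.
have mp i : measurable_fun setT (fun om => phi (x t om) i 0).
  exact: (measurableT_comp (mphi i) mx).
rewrite /zvec.
have colE p q (A : T -> 'cV[R]_p) (B : T -> 'cV[R]_q) i :
    (fun om => col_mx (A om) (B om) i 0) =
    (match fintype.split i with inl i1 => fun om => A om i1 0 | inr i2 => fun om => B om i2 0 end).
  by apply/funext => om; rewrite mxE; case: fintype.split.
rewrite colE; case: fintype.split => i; last first.
  have -> : (fun om => (kappa w (a ^~ om) t)%:M i (0 : 'I_1)) =
      (fun om => \sum_(1 <= s < t) w t s * (a s om)%:R).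
    by apply/funext => om; rewrite mxE ord1 eqxx.
  apply: measurable_sum_nat => s /andP[s1 st]; apply: measurable_funM => //.
  by apply: measurable_bool_natr; apply: ma; rewrite s1 ltnW.
rewrite colE; case: fintype.split => l.
  have -> : (fun om => ((1 - (a t om)%:R) *: phi (x t om)) l 0) =
    (fun om => (1 - (a t om)%:R) * phi (x t om) l 0).
    by apply/funext => om; rewrite mxE.
  by apply: measurable_funM => //; apply: measurable_funB.
have -> : (fun om => ((a t om)%:R *: phi (x t om)) l 0) =
  (fun om => (a t om)%:R * phi (x t om) l 0) by apply/funext => om; rewrite mxE.
exact: measurable_funM.
Qed.

End measurable_matrices.

(** * The past, the noise and the noise sums in the reward model *)

Lemma events_of_measurable d d' (T : measurableType d) (E : measurableType d')
    (X : T -> E) : measurable_fun setT X -> events_of X `<=` measurable.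
Proof. by move=> mX _ [B mB <-]; exact: mX. Qed.

Lemma measurable_fun_events_of d d' (T : measurableType d) (E : measurableType d')
    (G : set (set T)) (X : T -> E) :
  events_of X `<=` G -> measurable_fun setT (X : g_sigma_algebraType G -> E).
Proof.
by move=> XG _ B mB; apply: sub_sigma_algebra; apply: XG; exists B.
Qed.

Lemma measure_bigsetU_le d (T : measurableType d) (R : realType)
    (P : probability T R) (I : Type) (r : seq I) (F : I -> set T) (b : R) :
  (forall i, measurable (F i)) -> (forall i, P (F i) <= b%:E)%E ->
  (P (\big[setU/set0]_(i <- r) F i) <= ((size r)%:R * b)%:E)%E.
Proof.
move=> mF Fb; elim: r => [|i r ih]; first by rewrite big_nil measure0 mul0r.
rewrite big_cons /=; have -> : (size r).+1%:R * b = b + (size r)%:R * b.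
  by rewrite -[(size r).+1%:R]natr1; ring.
rewrite EFinD.
apply: (le_trans (measureU2 _ _ _))  => //; last exact: (leeD (Fb i) ih).
exact: bigsetU_measurable.
Qed.

Section reward_noise.
Context (R : realType) (d0 d1 : nat)
    (phi : d0.-tuple R -> 'cV[R]_d1) (w : nat -> nat -> R)
    (beta0 beta1 : 'cV[R]_d1) (gamma : R)
    (PX : probability (d0.-tuple R) R)
    (sigma : R) (sigma_ : bool -> R)
    (Pe : bool -> probability (measurableTypeR R) R)
    (disp : measure_display) (T : measurableType disp) (P : probability T R)
    (x : nat -> {RV P >-> d0.-tuple R}) (a : nat -> {RV P >-> bool})
    (y e : nat -> {RV P >-> R})
    (hmodel : reward_model phi w beta0 beta1 gamma PX sigma sigma_ Pe x a y e).

(** Generators of the sigma-algebra of [x_s] and [H_{s-1}], the one in [noise_cond_indep]; the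
    action [a_s] is left out. *)
Definition past_events (s : nat) : set (set T) :=
  hist_events x a y s.-1 `|` events_of (x s).

Lemma past_events_measurable s : <<s past_events s >> `<=` measurable.
Proof.
apply: smallest_sub; first exact: sigma_algebra_measurable.
have mev d' (E : measurableType d') (X : {mfun T >-> E}) : events_of X `<=` measurable.
  exact: events_of_measurable.
by move=> B [[r _ [[]|]]|]; exact: mev.
Qed.

Lemma hist_events_past s r : (1 <= r < s)%N ->
  events_of (x r) `|` events_of (a r) `|` events_of (y r) `<=` past_events s.
Proof.
move=> /andP[r1 rs] B rB; left; exists r => //=; rewrite r1/=.
by case: s rs => // s; rewrite ltnS.
Qed.

Lemma measurable_context_past s r : (1 <= r <= s)%N ->
  measurable_fun setT (x r : g_sigma_algebraType (past_events s) -> d0.-tuple R).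
Proof.
move=> /andP[r1]; rewrite leq_eqVlt => /orP[/eqP ->|rs].
  by apply: measurable_fun_events_of => B; right.
apply: measurable_fun_events_of; apply: subset_trans (@hist_events_past s r _); last by rewrite r1.
by move=> B; left; left.
Qed.

Lemma measurable_action_past s r : (1 <= r < s)%N ->
  measurable_fun setT (a r : g_sigma_algebraType (past_events s) -> bool).
Proof.
move=> rs; apply: measurable_fun_events_of; apply: subset_trans (hist_events_past rs).
by move=> B; left; right.
Qed.

Lemma measurable_reward_past s r : (1 <= r < s)%N ->
  measurable_fun setT (y r : g_sigma_algebraType (past_events s) -> R).
Proof.
move=> rs; apply: measurable_fun_events_of; apply: subset_trans (hist_events_past rs).
by move=> B; right.
Qed.

Lemma noiseE s om : (1 <= s)%N -> y s om =
  ((zvec phi w (path_of x om) (path_of a om) s)^T *m theta beta0 beta1 gamma) 0 0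
  + e s om.
Proof. by move=> s1; rewrite (rewardE hmodel)// mean_rewardE. Qed.

(** The history records rewards, not noises, but an earlier noise is recovered from it as reward
    minus mean reward. *)
Lemma measurable_noise_past s r : (1 <= r < s)%N ->
  measurable_fun setT (e r : g_sigma_algebraType (past_events s) -> R).
Proof.
move=> rs; have /andP[r1 rs'] := rs.
have -> : (e r : T -> R) = (fun om => y r om -
    ((zvec phi w (path_of x om) (path_of a om) r)^T *m theta beta0 beta1 gamma) 0 0).
  by apply/funext => om; rewrite noiseE// addrC addKr.
apply: measurable_funB; first exact: measurable_reward_past.
apply: (@mx_measurable_mul _ (g_sigma_algebraType (past_events s)) _ _ _ _
  (fun om => (zvec phi w (path_of x om) (path_of a om) r)^T)
  (fun=> theta beta0 beta1 gamma)); last first.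
  by move=> i j; exact: measurable_cst.
apply: mx_measurable_trmx.
apply: (@mx_measurable_zvec _ (g_sigma_algebraType (past_events s)) _ _ _ phi w
  (fun r om => x r om) (fun r om => a r om)) => //.
- exact: phi_measurable hmodel.
- by apply: measurable_context_past; rewrite r1 ltnW.
- move=> q /andP[q1 qr]; apply: measurable_action_past.
  by rewrite q1 (leq_ltn_trans qr).
Qed.

(** Insert the conditional law into the multiplied-out independence and cancel [P(a_s = i)]; when
    this probability is 0 both sides vanish. *)
Lemma noise_indep_past s i D B : (1 <= s)%N -> <<s past_events s >> D ->
  measurable B ->
  P (a s @^-1` [set i] `&` e s @^-1` B `&` D) =
  (P (a s @^-1` [set i] `&` D) * Pe i B)%E.
Proof.
move=> s1 GD mB.
have mD := past_events_measurable GD.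
have mA : measurable (a s @^-1` [set i]).
  exact: measurable_funPTI.
have mE : measurable (e s @^-1` B).
  exact: measurable_funPTI.
have := noise_cond_indep hmodel i s1 mB GD; rewrite (noise_cond_law hmodel i s1 mB).
have [A0 _|A0] := eqVneq (P (a s @^-1` [set i])) 0%E.
  have sub0 C : measurable C -> C `<=` a s @^-1` [set i] -> P C = 0%E.
    move=> mC CA; apply/eqP; rewrite eq_le measure_ge0 andbT -A0.
    by apply: le_measure => //; rewrite inE.
  rewrite !sub0 ?mul0e//; do ?[exact: measurableI|by move=> ? []].
  - by apply: measurableI => //; exact: measurableI.
  - by move=> ? [[]].
move=> key.
have fA : P (a s @^-1` [set i]) \is a fin_num by rewrite fin_num_measure.
have gA : (0 < P (a s @^-1` [set i]))%E by rewrite lt0e A0 measure_ge0.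
have {}key : (P (a s @^-1` [set i] `&` e s @^-1` B `&` D) * P (a s @^-1` [set i]) =
    P (a s @^-1` [set i] `&` D) * Pe i B * P (a s @^-1` [set i]))%E.
  by rewrite key [LHS]muleC [X in (_ * X = _)%E]muleC muleA.
by apply/eqP; rewrite eq_le; apply/andP; split; rewrite -(lee_pmul2r fA gA) key.
Qed.

(* The j-th coordinate of z_s had the action at time s been i: unlike z_s itself, it
   is measurable with respect to the past.  The bound on the features holds only
   almost surely; the cut-off makes it hold everywhere. *)
Definition trunc_feature (L : R) (j : 'I_(d1 + d1 + 1)) (s : nat) (i : bool) (om : T) : R :=
  let v := zvec phi w (path_of x om) (fun r => if r == s then i else a r om) s j 0 in
  if `|v| <= L then v else 0.

Lemma trunc_feature_le L j s i om : 0 <= L -> `|trunc_feature L j s i om| <= L.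
Proof. by move=> L0; rewrite /trunc_feature; case: ifP => //; rewrite normr0. Qed.

Lemma trunc_featureE L j s om :
  `|zvec phi w (path_of x om) (path_of a om) s j 0| <= L ->
  trunc_feature L j s (a s om) om = zvec phi w (path_of x om) (path_of a om) s j 0.
Proof.
rewrite /trunc_feature.
have -> : (fun r => if r == s then a s om else a r om) = path_of a om.
  by apply/funext => r; rewrite /path_of; case: eqP => [->|].
by move=> ->.
Qed.

(** The case [r = s] is allowed because the action at time [r] is frozen to [i]; the other actions
    involved are strictly earlier. *)
Lemma measurable_trunc_feature_past L j s r i : (1 <= r <= s)%N ->
  measurable_fun setT
    (trunc_feature L j r i : g_sigma_algebraType (past_events s) -> R).
Proof.
move=> rs; have /andP[r1 rs'] := rs.
pose U := g_sigma_algebraType (past_events s).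
pose z (om : U) := zvec phi w (path_of x om) (fun q => if q == r then i else a q om) r.
have mz : mx_measurable z.
  apply: (@mx_measurable_zvec _ U _ _ _ phi w
    (fun r om => x r om) (fun q om => if q == r then i else a q om)) => //.
  - exact: phi_measurable hmodel.
  - exact: measurable_context_past.
  - move=> q /andP[q1 qr]; case: eqP => [_|/eqP qr']; first exact: measurable_cst.
    by apply: measurable_action_past; rewrite q1 (leq_trans _ rs')// ltn_neqAle qr'.
have mzj : measurable_fun setT (fun om : U => z om j 0) by exact: mz.
apply: (@measurable_fun_ifT _ _ U R (fun om => z om j 0) (fun=> 0)
  (fun om => `|z om j 0| <= L)) => //.
by apply: measurable_fun_ler => //; exact: measurableT_comp.
Qed.

Lemma measurable_noise_sum_past L j s :
  measurable_fun setT ((fun om => \sum_(1 <= r < s) trunc_feature L j r (a r om) om * e r om)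
    : g_sigma_algebraType (past_events s) -> R).
Proof.
apply: (@measurable_sum_nat _ (g_sigma_algebraType (past_events s)) R 1 s
  (fun r om => trunc_feature L j r (a r om) om * e r om)) => r rs.
have /andP[r1 rs'] := rs.
apply: measurable_funM; last exact: measurable_noise_past.
have -> : (fun om => trunc_feature L j r (a r om) om) =
    (fun om => if a r om then trunc_feature L j r true om else trunc_feature L j r false om).
  by apply/funext => om; case: (a r om).
apply: measurable_fun_ifT; first exact: measurable_action_past.
- by apply: measurable_trunc_feature_past; rewrite r1 ltnW.
- by apply: measurable_trunc_feature_past; rewrite r1 ltnW.
Qed.

Lemma measurable_noise_sum L j s :
  measurable_fun setT (fun om => \sum_(1 <= r < s) trunc_feature L j r (a r om) om * e r om).
Proof.
have mid : measurable_fun setT (idfun : T -> g_sigma_algebraType (past_events s)).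
  by move=> _ B mB; rewrite setTI; exact: (@past_events_measurable s _ mB).
have mc := measurableT_comp (@measurable_noise_sum_past L j s) mid; exact mc.
Qed.

(** Each of the [t] terms contributes [L^2 sigma^2] to the variance proxy, so the Chernoff bound
    applies with proxy [t L^2 sigma^2]. *)
Lemma noise_sum_tail L j t tau : 0 < L -> (1 <= t)%N -> 0 < tau ->
  (P [set om | (tau <=
       `|\sum_(1 <= s < t.+1) trunc_feature L j s (a s om) om * e s om|)%R] <=
   (2 * expR (- (tau ^+ 2 / (2 * (t%:R * L ^+ 2 * sigma ^+ 2)))))%:E)%E.
Proof.
move=> L0 t1 tau0; have s0 := sigma_gt0 hmodel.
apply: subgaussian_tail => //.
- exact: measurable_noise_sum.
- by rewrite !mulr_gt0 ?exprn_gt0// ltr0n.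
move=> u; have -> : t%:R * L ^+ 2 * sigma ^+ 2 * u ^+ 2 / 2 =
  t%:R * (u ^+ 2 * L ^+ 2 * sigma ^+ 2 / 2) by ring.
apply: (@subgaussian_sum_mgf _ T R P past_events Pe) => //.
- by move=> s s1; exact: past_events_measurable.
- by move=> s i s1; exact: measurable_funPTI.
- exact: noise_subgaussian hmodel.
- exact: noise_indep_past.
- by move=> s i s1; apply: measurable_trunc_feature_past; rewrite s1 leqnn.
- by move=> s i om s1; apply: trunc_feature_le; exact: ltW.
- by move=> s s1; exact: measurable_noise_sum_past.
Qed.

(** Each [x s] with [s >= 1] has law [PX], so it pulls the exceptional null set back to a null set;
    countably many times are then combined. Time 0 is vacuous. *)
Lemma context_bounded Lx : {ae PX, forall v, `|phi v| <= Lx} ->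
  {ae P, forall om s, (1 <= s)%N -> `|phi (x s om)| <= Lx}.
Proof.
move=> [N [mN N0 subN]]; apply: ae_foralln => s.
have [s1|] := leqP 1 s; last by rewrite ltnS leqn0 => /eqP ->; apply: aeW.
exists (x s @^-1` N); split.
- exact: measurable_funPTI.
- by have [law _] := context_iid hmodel; exact: (etrans (law s N s1 mN) N0).
- by move=> om /= H; apply: subN => /= Hx; apply: H.
Qed.

End reward_noise.

(** * Deterministic error bound, union bound and conclusion *)

(** The pathwise half of the proof. The threshold is chosen so that, after division by [t] and
    multiplication by [n] in [l1norm_lambda_min], it leaves [c * h]; then [c < lambda_min] gives the
    bound. *)
Lemma estimator_l1_error (R : realType) n (z : nat -> 'cV[R]_n) (y e : nat -> R)
    (th : 'cV[R]_n) t (c h : R) :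
  (1 <= t)%N -> 0 < c -> 0 <= h -> c < lambda_min (gram z t) ->
  (forall s, (1 <= s)%N -> y s = ((z s)^T *m th) 0 0 + e s) ->
  (forall j, `|\sum_(1 <= s < t.+1) z s j 0 * e s| <= t%:R * h * c / n%:R) ->
  l1norm (estimator z y t - th) <= h.
Proof.
move=> t1 c0 h0 cl yE small.
have l0 := lt_trans c0 cl.
have gU := lambda_min_gt0_unitmx (gram_sym z t) l0.
have t0 : 0 < t%:R :> R by rewrite ltr0n.
have d0 : 0 <= h * c / n%:R by rewrite divr_ge0// mulr_ge0// ltW.
(* In dimension 0 the norm is an empty sum; otherwise division by the dimension is legitimate. *)
case: n => [|n] in z th cl small l0 gU d0 yE *.
  by rewrite /l1norm big_ord0.
have := @l1norm_lambda_min _ _ _ (estimator z y t - th) (h * c / n.+1%:R)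
  (gram_sym z t) d0 _ (ltW l0).
rewrite (gram_estimator_error gU yE) => bound.
have {bound} : lambda_min (gram z t) * l1norm (estimator z y t - th) <=
    n.+1%:R * (h * c / n.+1%:R).
  apply: bound => j; rewrite mxE summxE normrM gtr0_norm ?invr_gt0//.
  rewrite ler_pdivrMl// !mulrA; apply: le_trans (small j).
  by under eq_bigr do rewrite mxE mulrC.
rewrite [leRHS]mulrC divfK ?pnatr_eq0// => bound.
have v0 : 0 <= l1norm (estimator z y t - th) by rewrite sumr_ge0.
rewrite -(ler_pM2l c0) [leRHS]mulrC; apply: le_trans bound.
by rewrite ler_wpM2r// ltW.
Qed.

Theorem theorem2 (R : realType) (d0 d1 : nat)
    (phi : d0.-tuple R -> 'cV[R]_d1) (w : nat -> nat -> R)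
    (beta0 beta1 : 'cV[R]_d1) (gamma : R)
    (PX : probability (d0.-tuple R) R)
    (sigma : R) (sigma_ : bool -> R)
    (Pe : bool -> probability (measurableTypeR R) R)
    (I : front_inputs R)
    (disp : measure_display) (T : measurableType disp) (P : probability T R)
    (x : nat -> {RV P >-> d0.-tuple R}) (a b : nat -> {RV P >-> bool})
    (y e : nat -> {RV P >-> R}) (S : nat -> T -> bool)
    (Lx lam Lz : R)
    (hI : front_inputs_ok I)
    (hmodel : reward_model phi w beta0 beta1 gamma PX sigma sigma_ Pe x a y e)
    (hfront : front_run phi w I x a b y S)
    (hbound : boundedness phi w PX Lx lam Lz)
    (t : nat) (ht : (1 <= t)%N)
    (hclip : clipping_at phi w I x a t)
    (h : R) (hh : 0 < h) :
  let d : R := (2 * d1 + 1)%N%:R in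
  let C : R := clipC I in
  ((1 - 4 * d1%:R * expR (- (t%:R * eps I t ^+ 2 * C ^+ 2 * h ^+ 2
                             / (2 * d ^+ 2 * sigma ^+ 2 * Lz ^+ 2)))
      - 4 * expR (- (t%:R * eps I t ^+ 2 * C ^+ 2 * h ^+ 2
                     / (8 * d ^+ 2 * sigma ^+ 2 * Lz ^+ 2))))%:E
   <= P [set om | (
        l1norm (estimator (zvec phi w (path_of x om) (path_of a om))
                          (path_of y om) t
                - theta beta0 beta1 gamma) <= h)%R])%E.
Proof.
cbv zeta; set d : R := (2 * d1 + 1)%N%:R; set C : R := clipC I.
have [C0 _ epsI] := hI; have /andP[eps0 _] := epsI t ht.
(* If [eps I t = 0], both exponentials are 1 and the claimed lower bound is [-3 - 4 d1], which is
   negative. *)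
move: eps0; rewrite le_eqVlt => /orP[/eqP eps0|eps0].
  apply: le_trans (measure_ge0 _ _); rewrite -eps0 expr0n/= !(mulr0, mul0r) oppr0 expR0.
  by rewrite lee_fin; have : 0 <= d1%:R :> R by []; lra.
have sigma0 := sigma_gt0 hmodel.
have Lz0 : 0 < Lz := lt_le_trans (Lx_gt0 hbound) (Lx_le_Lz hbound).
have t0 : 0 < t%:R :> R by rewrite ltr0n.
have d0' : 0 < d by rewrite ltr0n addn1.
set E := [set om | _].
pose c := C * eps I t; have c0 : 0 < c by rewrite mulr_gt0.
(* The threshold of [estimator_l1_error], with [c] the clipping level. *)
pose tau := t%:R * h * c / d; have tau0 : 0 < tau by rewrite divr_gt0 ?mulr_gt0.
pose X j om := \sum_(1 <= s < t.+1) trunc_feature phi w x a Lz j s (a s om) om * e s om.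
pose B j : set T := [set om | (tau <= `|X j om|)%R].
have mX j : measurable_fun setT (X j) by exact: (measurable_noise_sum hmodel).
have mB j : measurable (B j).
  rewrite -[B j]setTI; apply: measurable_fun_le => //.
  exact: measurableT_comp.
have mE : measurable E.
  rewrite -[E]setTI; apply: measurable_fun_le => //.
  apply: measurable_l1norm.
  have mest : mx_measurable (fun om => estimator
      (zvec phi w (path_of x om) (path_of a om)) (path_of y om) t).
    apply: (@mx_measurable_estimator _ _ _ _
      (fun s om => zvec phi w (path_of x om) (path_of a om) s) (fun s om => y s om)) => //
      s /andP[s1 _].
    apply: (@mx_measurable_zvec _ _ _ _ _ phi w (fun r om => x r om) (fun r om => a r om)) => //.
    exact: phi_measurable hmodel.
  move=> i j; have -> : (fun om => (estimator (zvec phi w (path_of x om) (path_of a om))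
      (path_of y om) t - theta beta0 beta1 gamma) i j) = (fun om =>
      estimator (zvec phi w (path_of x om) (path_of a om)) (path_of y om) t i j
      - theta beta0 beta1 gamma i j) by apply/funext => om; rewrite !mxE.
  by apply: measurable_funB => //; exact: mest.
(* A single null set [N] gathers the failures of clipping at time [t] and of the feature bound at
   all times. *)
have [N [mN N0 subN]] : {ae P, forall om, c < lambda_min
      (gram (zvec phi w (path_of x om) (path_of a om)) t) /\
    forall s, (1 <= s)%N -> `|phi (x s om)| <= Lx}.
  have := context_bounded hmodel (phi_bounded hbound).
  by move: hclip; apply: filterS2 => om.
pose U := \big[setU/set0]_(j <- enum 'I_(d1 + d1 + 1)) B j.
have mU : measurable U by exact: bigsetU_measurable.
(* Covering the whole space turns the bound on the failure probability into
   [1 <= P E + P N + P U]. *)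
have cover : E `|` (N `|` U) = setT.
  apply/seteqP; split => // om _.
  have [Nom|Nom] := pselect (N om); first by right; left.
  have [Uom|Uom] := pselect (U om); first by right; right.
  left; have [clip bnd] : c < lambda_min
      (gram (zvec phi w (path_of x om) (path_of a om)) t) /\
    forall s, (1 <= s)%N -> `|phi (x s om)| <= Lx.
    by apply: contrapT => H; apply: Nom; exact: subN.
  apply: (@estimator_l1_error _ _ _ _ (fun s => e s om) _ _ c) => //; first exact: ltW.
    by move=> s s1; rewrite /path_of (noiseE hmodel).
  move=> j; have -> : \sum_(1 <= s < t.+1)
      zvec phi w (path_of x om) (path_of a om) s j 0 * e s om = X j om.
    (* Outside [N] the features are bounded by [Lz], so the cut-off is inactive. *)
    apply: eq_big_nat => s /andP[s1 _]; rewrite trunc_featureE//.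
    apply: zvec_le (Lx_le_Lz hbound) _ _; first exact: bnd.
    exact: (w_bounded hbound s1).
  have dE : (d1 + d1 + 1)%:R = d by rewrite /d mul2n addnn.
  rewrite dE leNgt; apply/negP => Xj; apply: Uom.
  by rewrite /U -bigcup_seq; exists j => /=; [rewrite mem_enum|exact: ltW].
pose q := expR (- (tau ^+ 2 / (2 * (t%:R * Lz ^+ 2 * sigma ^+ 2)))).
have PU : (P U <= ((d1 + d1 + 1)%N%:R * (2 * q))%:E)%E.
  rewrite -[(d1 + d1 + 1)%N]size_enum_ord.
  by apply: measure_bigsetU_le => // j; exact: (noise_sum_tail hmodel).
have : (1 <= P E + ((d1 + d1 + 1)%N%:R * (2 * q))%:E)%E.
  rewrite -(probability_setT P) -cover.
  apply: (le_trans (measureU2 _ _ _)) => //; first exact: measurableU.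
  apply: leeD => //; apply: (le_trans (measureU2 _ _ _)) => //.
  have PN : (P N <= 0)%E by rewrite le_eqVlt; apply/orP; left; apply/eqP.
  by rewrite -[leRHS]add0e; exact: leeD.
rewrite -(fineK (fin_num_measure P _ mE)) -EFinD !lee_fin => PE.
set q1 := expR (- _); set q2 := expR (- _).
(* The choice of [tau] makes the Chernoff exponent equal to the first exponent of the claim. *)
have qE : q1 = q.
  rewrite /q1 /q; congr (expR (- _)); rewrite /tau /c.
  by field; rewrite !gt_eqF.
have q12 : q <= q2.
  rewrite -qE ler_expR lerN2; apply: ler_wpM2l; first by rewrite !mulr_ge0 ?sqr_ge0 ?ltW.
  rewrite lef_pV2 ?posrE ?mulr_gt0 ?exprn_gt0//.
  by rewrite !ler_wpM2r ?sqr_ge0// ler_nat.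
move: PE; rewrite !natrD qE => PE.
have := expR_ge0 (- (tau ^+ 2 / (2 * (t%:R * Lz ^+ 2 * sigma ^+ 2)))); rewrite -/q => q0.
(* [2 (2 d1 + 1) q = 4 d1 q + 2 q], and [2 q <= 4 q2] since [0 <= q <= q2]. *)
nra.
Qed.
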